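(* For the T8 network, the linear coding capacity is at most $48/49$ over any finite field alphabet of characteristic not equal to $3$. The linear coding capacity of the T8 network over any finite field alphabet of characteristic $3$, and the coding capacity of the T8 network, are both equal to $1$.
   Context: The T8 network has four source messages $A,B,C,D$. Its coding constraints are as follows. Let $\mathcal{A}$ be a finite alphabet with at least two elements and $k,n$ positive integers. Each message is an arbitrary vector in $\mathcal{A}^k$, and each network edge carries a vector in $\mathcal{A}^n$. There are four coding edges, carrying vectors $Z,W,X,Y\in\mathcal{A}^n$: - edge $(n_1,n_2)$ carries $Z$, a function of the messages $A,B,C$; - edge $(n_3,n_4)$ carries $W$, a function of the messages $B,C,D$; - edge $(n_5,n_6)$ carries $X$, a function of the messages $A,C,D$; - edge $(n_7,n_8)$ carries $Y$, a function of $W,X,Z$. There are seven demand nodes, each of which must recover its demanded message, for all message values, as a function of its inputs: - $n_9$ has inputs $B,D,Y$ and demands $A$; - $n_{10}$ has inputs $A,W,Z$ and demands $D$; - $n_{11}$ has inputs $D,Y,Z$ and demands $C$; - $n_{12}$ has inputs $D,X,Z$ and demands $B$; - $n_{13}$ has inputs $B,X,Y$ and demands $C$; - $n_{14}$ has inputs $A,W,Y$ and demands $C$; - $n_{15}$ has inputs $A,W,X$ and demands $B$. A $(k,n)$-coding solution over $\mathcal{A}$ is a choice of the four edge functions and seven decoding functions such that every demand is met for all $(A,B,C,D)\in(\mathcal{A}^k)^4$. The coding capacity is $\sup\{k/n : \text{there exists a } (k,n)\text{-coding solution}\}$. If the alphabet is a finite field $F$, a solution is linear if all edge and decoding functions are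 $F$-linear (linear combinations of the input vectors with matrix coefficients over $F$); the linear coding capacity over $F$ is $\sup\{k/n : \text{there exists a linear } (k,n)\text{-coding solution over } F\}$. *)

(* Defs.v *)
From HB Require Import structures.
From mathcomp Require Import all_boot all_order all_algebra.
From mathcomp Require Import all_classical all_reals all_analysis.

Set Implicit Arguments.
Unset Strict Implicit.
Unset Printing Implicit Defensive.

Import Order.TTheory GRing.Theory Num.Theory.

Local Open Scope classical_set_scope.
Local Open Scope ring_scope.

(* A vector over the alphabet A is a column 'cV[A]_k; this type carries no
   algebraic structure on A.  The order of the arguments of each function is the
   order in which the inputs are listed in the type comment next to it. *)
Record T8_code (A : Type) (k n : nat) : Type := T8Code {
  edgeZ : 'cV[A]_k -> 'cV[A]_k -> 'cV[A]_k -> 'cV[A]_n; (* A, B, C *)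
  edgeW : 'cV[A]_k -> 'cV[A]_k -> 'cV[A]_k -> 'cV[A]_n; (* B, C, D *)
  edgeX : 'cV[A]_k -> 'cV[A]_k -> 'cV[A]_k -> 'cV[A]_n; (* A, C, D *)
  edgeY : 'cV[A]_n -> 'cV[A]_n -> 'cV[A]_n -> 'cV[A]_n; (* W, X, Z *)
  dec9  : 'cV[A]_k -> 'cV[A]_k -> 'cV[A]_n -> 'cV[A]_k; (* B, D, Y *)
  dec10 : 'cV[A]_k -> 'cV[A]_n -> 'cV[A]_n -> 'cV[A]_k; (* A, W, Z *)
  dec11 : 'cV[A]_k -> 'cV[A]_n -> 'cV[A]_n -> 'cV[A]_k; (* D, Y, Z *)
  dec12 : 'cV[A]_k -> 'cV[A]_n -> 'cV[A]_n -> 'cV[A]_k; (* D, X, Z *)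
  dec13 : 'cV[A]_k -> 'cV[A]_n -> 'cV[A]_n -> 'cV[A]_k; (* B, X, Y *)
  dec14 : 'cV[A]_k -> 'cV[A]_n -> 'cV[A]_n -> 'cV[A]_k; (* A, W, Y *)
  dec15 : 'cV[A]_k -> 'cV[A]_n -> 'cV[A]_n -> 'cV[A]_k  (* A, W, X *)
}.

(* The messages A, B, C, D are written a, b, c, d. *)
Definition T8_solution (A : Type) (k n : nat) (s : T8_code A k n) : Prop :=
  forall a b c d : 'cV[A]_k,
    let z := edgeZ s a b c in
    let w := edgeW s b c d in
    let x := edgeX s a c d in
    let y := edgeY s w x z in
    (dec9 s b d y = a) /\
    (dec10 s a w z = d) /\
    (dec11 s d y z = c) /\
    (dec12 s d x z = b) /\
    (dec13 s b x y = c) /\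
    (dec14 s a w y = c) /\
    (dec15 s a w x = b).

Definition linear3 (F : fieldType) (p q r s : nat)
    (f : 'cV[F]_p -> 'cV[F]_q -> 'cV[F]_r -> 'cV[F]_s) : Prop :=
  exists (M1 : 'M[F]_(s, p)) (M2 : 'M[F]_(s, q)) (M3 : 'M[F]_(s, r)),
    forall u v w, f u v w = M1 *m u + M2 *m v + M3 *m w.

Definition T8_linear (F : fieldType) (k n : nat) (s : T8_code F k n) : Prop :=
  linear3 (edgeZ s) /\ linear3 (edgeW s) /\
  linear3 (edgeX s) /\ linear3 (edgeY s) /\
  linear3 (dec9 s) /\ linear3 (dec10 s) /\ linear3 (dec11 s) /\
  linear3 (dec12 s) /\ linear3 (dec13 s) /\ linear3 (dec14 s) /\
  linear3 (dec15 s).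

(* Suprema are taken in the extended reals, since the real-valued [sup] is 0 by
   convention on a set without supremum. *)
Definition sup_rate (R : realType) (P : nat -> nat -> Prop) : \bar R :=
  ereal_sup [set r | exists k n : nat,
    [/\ (0 < k)%N, (0 < n)%N, P k n & r = (k%:R / n%:R : R)%:E]].

Definition T8_capacity_over (R : realType) (A : finType) : \bar R :=
  sup_rate R (fun k n => exists s : T8_code A k n, T8_solution s).

Definition T8_capacity (R : realType) : \bar R :=
  sup_rate R (fun k n => exists A : finType,
    (1 < #|A|)%N /\ exists s : T8_code A k n, T8_solution s).

Definition T8_linear_capacity (R : realType) (F : finFieldType) : \bar R :=
  sup_rate R (fun k n => exists s : T8_code F k n, T8_solution s /\ T8_linear s).

(* Main.v *)
(* In a linear solution with k = n every block and every decoder is invertible.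
   Normalising the C-blocks of W, X, Z to the identity, node 9 forces the
   C-block P + Q + R of Y = P W + Q X + R Z to vanish, while the remaining nodes
   force P, Q and R to be equal and invertible; so 3 = 0.  For k < n the same
   computation is carried out modulo matrices whose rank is a multiple of n - k:
   if G and T are the coefficients of Y in the decoders of nodes 11 and 14, then
   G P W3, G Q X3, T Q X3 and T R Z3 are all close to the identity, and T P W3
   to -2 I, hence G - T is small and 3 I = (G - T) P W3 + (small).
   This yields k <= 22 (n - k).

   In characteristic 3 the code Z = A+B+C, W = B+C+D, X = A+C+D, Y = W+X+Z
   works.  Over an alphabet of size q, it is transported from F_3^m by injections
   A^k -> F_3^m -> A^(k+1), where q^k <= 3^m < q^(k+1). *)
Require Import Defs.
From HB Require Import structures.
From mathcomp Require Import all_boot all_order all_algebra.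
From mathcomp Require Import all_classical all_reals all_analysis.
From mathcomp Require Import ring lra zify.

Set Implicit Arguments.
Unset Strict Implicit.
Unset Printing Implicit Defensive.

Import Order.TTheory GRing.Theory Num.Theory.

Local Open Scope classical_set_scope.
Local Open Scope ring_scope.

(** * Rank estimates for matrices with a left inverse *)

Lemma mxrankB_le (F : fieldType) m n (A B : 'M[F]_(m, n)) :
  (\rank (A - B)%R <= \rank A + \rank B)%N.
Proof. by rewrite -(mxrank_opp B) mxrank_add. Qed.

Lemma rank_left_inv (F : fieldType) k n (E : 'M[F]_(k, n)) (V : 'M[F]_(n, k)) :
  E *m V = 1%:M -> \rank V = k.
Proof.
move=> EV; apply/eqP; rewrite eqn_leq rank_leq_col /=.
by rewrite -{1}(mxrank1 F k) -EV mxrankM_maxr.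
Qed.

(** [1%:M - V *m E] kills the image of [V], which has dimension [k]. *)
Lemma left_inv_defect (F : fieldType) k n
    (E : 'M[F]_(k, n)) (V : 'M[F]_(n, k)) :
  E *m V = 1%:M -> (\rank (1%:M - V *m E)%R <= n - k)%N.
Proof.
move=> EV; have := mxrank_mul_min (1%:M - V *m E) V.
rewrite mulmxBl mul1mx -mulmxA EV mulmx1 subrr mxrank0 (rank_left_inv EV).
lia.
Qed.

Section Transfer.
Variables (F : fieldType) (k n p c : nat).
Variables (E G : 'M[F]_(k, n)) (V0 : 'M[F]_(n, k)).
Hypothesis EV0 : E *m V0 = 1%:M.

(** Write [V] as [V0 *m E *m V] plus the defect [(1%:M - V0 *m E) *m V], and replace [E *m V] by
    [- G *m U]. *)
Let transfer_split (al be : 'M[F]_(p, n)) (U V : 'M[F]_(n, c)) :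
  E *m V + G *m U = 0 ->
  al *m U + be *m V =
  (al - be *m V0 *m G) *m U + be *m (1%:M - V0 *m E) *m V.
Proof.
move/eqP; rewrite addr_eq0 => /eqP EV.
rewrite mulmxBr mulmx1 !mulmxBl -!mulmxA EV !mulmxN opprK.
by rewrite addrACA addNr addr0.
Qed.

Let defect_le (be : 'M[F]_(p, n)) (V : 'M[F]_(n, c)) :
  (\rank (be *m (1%:M - V0 *m E) *m V)%R <= n - k)%N.
Proof.
apply: leq_trans (mxrankM_maxl _ _) _; apply: leq_trans (mxrankM_maxr _ _) _.
exact: left_inv_defect.
Qed.

(** After the split, one summand is a multiple of [U] and the other has rank at most [n - k]. *)
Lemma decoder_rank (al be : 'M[F]_(p, n)) (U V : 'M[F]_(n, c)) :
  E *m V + G *m U = 0 -> (\rank (al *m U + be *m V)%R <= \rank U + (n - k))%N.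
Proof.
move=> EV; rewrite (transfer_split _ _ EV); apply: leq_trans (mxrank_add _ _) _.
by rewrite leq_add // mxrankM_maxr.
Qed.

(* Up to rank [n - k], the equations [E V = - G U] say [V = - V0 G U], so
   [al U + be V] is a fixed matrix times [U]; this matrix is small because it
   almost kills [U1]. *)
Lemma decoder_transfer (al be : 'M[F]_(p, n)) (U1 V1 U2 V2 : 'M[F]_(n, c)) :
  E *m V1 + G *m U1 = 0 -> E *m V2 + G *m U2 = 0 ->
  al *m U1 + be *m V1 = 0 ->
  (\rank (al *m U2 + be *m V2)%R <= n - \rank U1 + 2 * (n - k))%N.
Proof.
move=> EV1 EV2.
rewrite (transfer_split _ _ EV1) (transfer_split _ _ EV2) => /eqP.
rewrite addr_eq0 => /eqP sm.
have := mxrank_mul_min (al - be *m V0 *m G) U1.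
rewrite sm mxrank_opp => /leq_trans/(_ (defect_le be V1)) leU1.
apply: leq_trans (mxrank_add _ _) _; rewrite mul2n -addnn addnA.
rewrite leq_add ?defect_le //; apply: leq_trans (mxrankM_maxl _ _) _.
have := rank_leq_row U1; lia.
Qed.

End Transfer.

(** * Rank bound from the block equations *)

(* The subscripts 1, 2, 3, 4 of Z, W, X, Y are the blocks for A, B, C, D; [Ei],
   [Fi], [Gi], ... are the blocks of the decoder of node [n_i]. *)
Lemma T8_rank_bound (F : fieldType) (k n : nat)
    (Z1 Z2 Z3 W2 W3 W4 X1 X3 X4 : 'M[F]_(n, k)) (P Q R : 'M[F]_n)
    (E9 E10 F10 G11 H11 K12 L12 S14 T14 U15 V15 : 'M[F]_(k, n)) :
  let Y1 := Q *m X1 + R *m Z1 in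
  let Y2 := P *m W2 + R *m Z2 in
  let Y3 := P *m W3 + Q *m X3 + R *m Z3 in
  let Y4 := P *m W4 + Q *m X4 in
  3%:R != 0 :> F -> (k <= n)%N ->
  E9 *m Y1 = 1%:M -> E9 *m Y3 = 0 ->
  E10 *m W4 = 1%:M -> E10 *m W2 + F10 *m Z2 = 0 -> E10 *m W3 + F10 *m Z3 = 0 ->
  G11 *m Y1 + H11 *m Z1 = 0 -> G11 *m Y2 + H11 *m Z2 = 0 ->
  G11 *m Y3 + H11 *m Z3 = 1%:M ->
  L12 *m Z2 = 1%:M -> L12 *m Z1 + K12 *m X1 = 0 -> L12 *m Z3 + K12 *m X3 = 0 ->
  S14 *m W2 + T14 *m Y2 = 0 -> S14 *m W4 + T14 *m Y4 = 0 ->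
  S14 *m W3 + T14 *m Y3 = 1%:M ->
  U15 *m W2 = 1%:M -> U15 *m W3 + V15 *m X3 = 0 -> U15 *m W4 + V15 *m X4 = 0 ->
  (k <= 22 * (n - k))%N.
Proof.
move=> Y1 Y2 Y3 Y4 three_neq0 le_kn e91 e93 e104 e102 e103 e111 e112 e113.
move=> e122 e121 e123 e142 e144 e143 e152 e153 e154.
have rY3 : (\rank Y3 <= n - k)%N.
  (* With [U] taken as 0, the estimate says that a matrix killed by [E9] has rank at most
     [n - k]. *)
  have := @decoder_rank _ _ _ n _ E9 0 Y1 e91 0 1%:M 0 Y3.
  by rewrite !mul0mx mul1mx add0r addr0 mxrank0 add0n; apply.
have rX1 : (k <= \rank X1 + (n - k))%N.
  (* Node 12 trades [Z1] for [X1] in [Y1], which has rank [k] by node 9. *)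
  by have := decoder_rank e122 Q R e121; rewrite (rank_left_inv e91).
have rX4 : (k <= \rank X4 + (n - k))%N.
  have := @decoder_rank _ _ _ n _ _ _ _ e152 0 1%:M _ _ e154.
  by rewrite mul0mx mul1mx add0r (rank_left_inv e104).
have rZ2 := rank_left_inv e122.
set e := (n - k)%N in rY3 rX1 rX4 *.
(* Node 12 carries the A-equation of node 11 over to the C-blocks; [n - \rank X1] is at most
   [2 * e], whence the 4. *)
have GP : (\rank (G11 *m P *m W3 - 1%:M)%R <= 4 * e)%N.
  have h : G11 *m Q *m X1 + (G11 *m R + H11) *m Z1 = 0.
    by rewrite -[RHS]e111 /Y1 mulmxDr mulmxDl !mulmxA addrA.
  have := decoder_transfer e122 e121 e123 h.
  have -> : G11 *m P *m W3 - 1%:M =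
      - (G11 *m Q *m X3 + (G11 *m R + H11) *m Z3).
    rewrite -e113 /Y3 !mulmxDr !mulmxDl !mulmxA.
    move: (G11 *m P *m W3) (G11 *m Q *m X3) (G11 *m R *m Z3) (H11 *m _).
    by move=> p q r s; apply/matrixP => i j; rewrite !mxE; ring.
  rewrite mxrank_opp; lia.
(* Node 10 transfers the B-equation of node 11; [Z2] has full rank [k], which saves one [e]. *)
have GQ : (\rank (G11 *m Q *m X3 - 1%:M)%R <= 3 * e)%N.
  have h : (G11 *m R + H11) *m Z2 + G11 *m P *m W2 = 0.
    by rewrite -[RHS]e112 /Y2 mulmxDr mulmxDl !mulmxA addrC addrA.
  have := decoder_transfer e104 e102 e103 h.
  have -> : G11 *m Q *m X3 - 1%:M =
      - ((G11 *m R + H11) *m Z3 + G11 *m P *m W3).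
    rewrite -e113 /Y3 !mulmxDr !mulmxDl !mulmxA.
    move: (G11 *m P *m W3) (G11 *m Q *m X3) (G11 *m R *m Z3) (H11 *m _).
    by move=> p q r s; apply/matrixP => i j; rewrite !mxE; ring.
  rewrite mxrank_opp; lia.
have TQ : (\rank (T14 *m Q *m X3 - 1%:M)%R <= 3 * e)%N.
  have h : T14 *m R *m Z2 + (T14 *m P + S14) *m W2 = 0.
    rewrite -[RHS]e142 /Y2 mulmxDr mulmxDl !mulmxA addrC.
    by rewrite (addrC (_ *m W2)) addrA.
  have := decoder_transfer e104 e102 e103 h.
  have -> : T14 *m Q *m X3 - 1%:M =
      - (T14 *m R *m Z3 + (T14 *m P + S14) *m W3).
    rewrite -e143 /Y3 !mulmxDr !mulmxDl !mulmxA.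
    move: (T14 *m P *m W3) (T14 *m Q *m X3) (T14 *m R *m Z3) (S14 *m _).
    by move=> p q r s; apply/matrixP => i j; rewrite !mxE; ring.
  rewrite mxrank_opp; lia.
(* Node 15 transfers the D-equation of node 14, by way of [X4]. *)
have TR : (\rank (T14 *m R *m Z3 - 1%:M)%R <= 4 * e)%N.
  have h : T14 *m Q *m X4 + (T14 *m P + S14) *m W4 = 0.
    rewrite -[RHS]e144 /Y4 mulmxDr mulmxDl !mulmxA addrC.
    by rewrite (addrC (_ *m W4)) addrA.
  have := decoder_transfer e152 e154 e153 h.
  have -> : T14 *m R *m Z3 - 1%:M =
      - (T14 *m Q *m X3 + (T14 *m P + S14) *m W3).
    rewrite -e143 /Y3 !mulmxDr !mulmxDl !mulmxA.
    move: (T14 *m P *m W3) (T14 *m Q *m X3) (T14 *m R *m Z3) (S14 *m _).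
    by move=> p q r s; apply/matrixP => i j; rewrite !mxE; ring.
  rewrite mxrank_opp; lia.
have rQX3 : (k <= \rank (Q *m X3)%R + 3 * e)%N.
  rewrite -[leqLHS](mxrank1 F) -[1%:M](subKr (G11 *m Q *m X3)).
  apply: leq_trans (mxrankB_le _ _) _; rewrite leq_add //.
  by rewrite -mulmxA mxrankM_maxr.
(* [(G11 - T14) *m (Q *m X3)] has rank at most [6 * e], and cancelling [Q *m X3] costs at most
   [4 * e] more. *)
have rGT : (\rank (G11 - T14)%R <= 10 * e)%N.
  have := mxrankB_le (G11 *m Q *m X3 - 1%:M) (T14 *m Q *m X3 - 1%:M).
  rewrite opprB addrA subrK -mulmxBl -mulmxBl -mulmxA.
  move=> /leq_trans/(_ (leq_add GQ TQ)).
  move=> /(leq_trans (mxrank_mul_min (G11 - T14) (Q *m X3))); lia.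
rewrite -[leqLHS](mxrank1 F) -(mxrank_scale_nz _ three_neq0).
(* Once [Y3] is expanded, everything cancels except three identities. *)
have -> : 3%:R *: 1%:M = (G11 - T14) *m (P *m W3) + T14 *m Y3
    - (G11 *m P *m W3 - 1%:M) - (T14 *m Q *m X3 - 1%:M)
    - (T14 *m R *m Z3 - 1%:M) :> 'M[F]_k.
  rewrite /Y3 !mulmxDr !mulmxBl !mulmxA.
  move: (T14 *m P *m _) (T14 *m Q *m _) (T14 *m R *m _) (G11 *m P *m _) 1%:M.
  by move=> p q r s t; apply/matrixP => i j; rewrite !mxE; ring.
(* The five bounds stand in the order of the summands. *)
apply: leq_trans (_ : 10 * e + e + 4 * e + 3 * e + 4 * e <= _)%N; last by lia.
do 3![apply: leq_trans (mxrankB_le _ _) _; apply: leq_add => //].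
apply: leq_trans (mxrank_add _ _) _.
apply: leq_add; first exact: leq_trans (mxrankM_maxl _ _) rGT.
exact: leq_trans (mxrankM_maxr _ _) rY3.
Qed.

(** * Block equations of a linear solution *)

Lemma mulmx_eq0P (F : fieldType) m n (M : 'M[F]_(m, n)) :
  (forall u : 'cV_n, M *m u = 0) -> M = 0.
Proof.
move=> M0; apply/trmx_inj/row_matrixP => i.
by rewrite -tr_col colE M0 !trmx0 row0.
Qed.

Lemma mulmx_eq1P (F : fieldType) n (M : 'M[F]_n) :
  (forall u : 'cV_n, M *m u = u) -> M = 1%:M.
Proof.
move=> M1; apply/eqP; rewrite -subr_eq0; apply/eqP/mulmx_eq0P => u.
by rewrite mulmxBl mul1mx M1 subrr.
Qed.

(** With a single nonzero message, a demand becomes one block equation: the identity for the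
    demanded message, zero for any other. *)
Lemma T8_linear_bound (F : fieldType) (k n : nat) (s : T8_code F k n) :
  3%:R != 0 :> F -> (k <= n)%N -> T8_solution s -> T8_linear s ->
  (k <= 22 * (n - k))%N.
Proof.
move=> three_neq0 le_kn sol [[Z1 [Z2 [Z3 hZ]]] [[W2 [W3 [W4 hW]]]]].
move=> [[X1 [X3 [X4 hX]]] [[P [Q [R hY]]]]].
move=> [[M1 [M2 [E9 h9]]] [[M3 [E10 [F10 h10]]] [[M4 [G11 [H11 h11]]]]]].
move=> [[M5 [K12 [L12 h12]]] [_ [[M6 [S14 [T14 h14]]]]]].
move=> [M7 [U15 [V15 h15]]].
pose lin := (hZ, hW, hX, hY, h9, h10, h11, h12, h14, h15,
  mulmx0, addr0, add0r).
pose asm := (mulmxDl, mulmxDr, mulmxA).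
apply: (@T8_rank_bound F k n Z1 Z2 Z3 W2 W3 W4 X1 X3 X4 P Q R
  E9 E10 F10 G11 H11 K12 L12 S14 T14 U15 V15) => //.
- by apply: mulmx_eq1P => u; have [+ _] := sol u 0 0 0; rewrite !lin !asm.
- by apply: mulmx_eq0P => u; have [+ _] := sol 0 0 u 0; rewrite !lin !asm.
- by apply: mulmx_eq1P => u; have [_ [+ _]] := sol 0 0 0 u; rewrite !lin !asm.
- by apply: mulmx_eq0P => u; have [_ [+ _]] := sol 0 u 0 0; rewrite !lin !asm.
- by apply: mulmx_eq0P => u; have [_ [+ _]] := sol 0 0 u 0; rewrite !lin !asm.
- apply: mulmx_eq0P => u; have [_ [_ [+ _]]] := sol u 0 0 0.
  by rewrite !lin !asm.
- apply: mulmx_eq0P => u; have [_ [_ [+ _]]] := sol 0 u 0 0.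
  by rewrite !lin !asm.
- apply: mulmx_eq1P => u; have [_ [_ [+ _]]] := sol 0 0 u 0.
  by rewrite !lin !asm.
- apply: mulmx_eq1P => u; have [_ [_ [_ [+ _]]]] := sol 0 u 0 0.
  by rewrite !lin !asm.
- apply: mulmx_eq0P => u; have [_ [_ [_ [+ _]]]] := sol u 0 0 0.
  by rewrite addrC !lin !asm.
- apply: mulmx_eq0P => u; have [_ [_ [_ [+ _]]]] := sol 0 0 u 0.
  by rewrite addrC !lin !asm.
- apply: mulmx_eq0P => u; have [_ [_ [_ [_ [_ [+ _]]]]]] := sol 0 u 0 0.
  by rewrite !lin !asm.
- apply: mulmx_eq0P => u; have [_ [_ [_ [_ [_ [+ _]]]]]] := sol 0 0 0 u.
  by rewrite !lin !asm.
- apply: mulmx_eq1P => u; have [_ [_ [_ [_ [_ [+ _]]]]]] := sol 0 0 u 0.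
  by rewrite !lin !asm.
- apply: mulmx_eq1P => u; have [_ [_ [_ [_ [_ [_ +]]]]]] := sol 0 u 0 0.
  by rewrite !lin !asm.
- apply: mulmx_eq0P => u; have [_ [_ [_ [_ [_ [_ +]]]]]] := sol 0 0 u 0.
  by rewrite !lin !asm.
- apply: mulmx_eq0P => u; have [_ [_ [_ [_ [_ [_ +]]]]]] := sol 0 0 0 u.
  by rewrite !lin !asm.
Qed.

(** * Codes over an arbitrary finite alphabet *)

(* Fixing B, C, D, node [n_9] recovers A from Y. *)
Lemma T8_solution_le (A : finType) (k n : nat) (s : T8_code A k n) :
  (1 < #|A|)%N -> T8_solution s -> (k <= n)%N.
Proof.
move=> A1 sol; have /card_gt0P [a0 _] : (0 < #|A|)%N by exact: ltnW.
pose c0 : 'cV[A]_k := const_mx a0.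
pose y a := edgeY s (edgeW s c0 c0 c0) (edgeX s a c0 c0) (edgeZ s a c0 c0).
have y_inj : injective y.
  move=> a a' eq_y; have [<- _] := sol a c0 c0 c0.
  have [<- _] := sol a' c0 c0 c0.
  by rewrite -/(y a) -/(y a') eq_y.
by have := leq_card y y_inj; rewrite !card_mx !muln1 leq_exp2l.
Qed.

(** The code over [B] is simulated over [A]: messages enter through [e], edge vectors over [B] are
    stored through [f], and [e'], [f'] undo this. *)
Lemma T8_transport (A B : Type) (k n k' n' : nat)
    (e : 'cV[A]_k -> 'cV[B]_k') (e' : 'cV[B]_k' -> 'cV[A]_k)
    (f : 'cV[B]_n' -> 'cV[A]_n) (f' : 'cV[A]_n -> 'cV[B]_n')
    (s : T8_code B k' n') :
  cancel e e' -> cancel f f' -> T8_solution s ->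
  exists t : T8_code A k n, T8_solution t.
Proof.
move=> eK fK sol.
exists (T8Code
  (fun a b c => f (edgeZ s (e a) (e b) (e c)))
  (fun b c d => f (edgeW s (e b) (e c) (e d)))
  (fun a c d => f (edgeX s (e a) (e c) (e d)))
  (fun w x z => f (edgeY s (f' w) (f' x) (f' z)))
  (fun b d y => e' (dec9 s (e b) (e d) (f' y)))
  (fun a w z => e' (dec10 s (e a) (f' w) (f' z)))
  (fun d y z => e' (dec11 s (e d) (f' y) (f' z)))
  (fun d x z => e' (dec12 s (e d) (f' x) (f' z)))
  (fun b x y => e' (dec13 s (e b) (f' x) (f' y)))
  (fun a w y => e' (dec14 s (e a) (f' w) (f' y)))
  (fun a w x => e' (dec15 s (e a) (f' w) (f' x)))).
move=> a b c d /=; rewrite !fK.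
by have [-> [-> [-> [-> [-> [-> ->]]]]]] := sol (e a) (e b) (e c) (e d);
  rewrite !eK.
Qed.

Lemma card_le_retract (T U : finType) (x0 : T) :
  (#|T| <= #|U|)%N -> exists (f : T -> U) (g : U -> T), cancel f g.
Proof.
move=> le_TU; pose f x := enum_val (widen_ord le_TU (enum_rank x)).
(* [x0] is the value off the image of [f]. *)
exists f, (fun y => odflt x0 [pick x | f x == y]) => x.
case: pickP => [x' /eqP /enum_val_inj/(congr1 val) /=|/(_ x)]; last first.
  by rewrite eqxx.
by move=> /val_inj /enum_rank_inj.
Qed.

(** * The code in characteristic 3 *)

Definition T8_code3 (F : comNzRingType) (k : nat) : T8_code F k k := T8Code
  (fun a b c => a + b + c) (fun b c d => b + c + d) (fun a c d => a + c + d)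
  (fun w x z => w + x + z)
  (fun b d y => - b - d - y) (fun a w z => a + w - z) (fun d y z => d + y + z)
  (fun d x z => d - x + z) (fun b x y => b + x + y) (fun a w y => a + w + y)
  (fun a w x => a + w - x).

(* In characteristic 3, Y = W + X + Z = - (A + B + D). *)
Lemma T8_solution3 (F : comNzRingType) (k : nat) :
  3%:R = 0 :> F -> T8_solution (T8_code3 F k).
Proof.
move=> F3 a b c d; do !split; apply/matrixP => i j; rewrite !mxE.
(* Each decoder returns its message up to 0, 1 or -1 times this vanishing sum. *)
all: have s0 : 3%:R * (a i j + b i j + c i j + d i j) = 0 by rewrite F3 mul0r.
all: first
  [ ring | rewrite -[RHS]addr0 -s0; ring | rewrite -[RHS]subr0 -s0; ring ].
Qed.

Lemma T8_linear3 (F : finFieldType) (k : nat) : T8_linear (T8_code3 F k).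
Proof.
do ![split]; rewrite /T8_code3 /linear3 /=.
all: first
  [ exists 1%:M, 1%:M, 1%:M => u v w; by rewrite !mul1mx
  | exists (- 1%:M), (- 1%:M), (- 1%:M) => u v w; by rewrite !mulNmx !mul1mx
  | exists 1%:M, (- 1%:M), 1%:M => u v w; by rewrite mulNmx !mul1mx
  | exists 1%:M, 1%:M, (- 1%:M) => u v w; by rewrite mulNmx !mul1mx ].
Qed.

(** * Suprema of rates and the capacities *)

Lemma sup_rate_le (R : realType) (r : R) (P : nat -> nat -> Prop) :
  (forall k n, (0 < n)%N -> P k n -> k%:R <= r * n%:R) ->
  (sup_rate R P <= r%:E)%E.
Proof.
move=> le_r; apply: ge_ereal_sup => _ [k [n [k0 n0 Pkn ->]]].
by rewrite lee_fin ler_pdivrMr ?ltr0n // le_r.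
Qed.

(** Rates at least [k / k.+1] with [k] unbounded come arbitrarily close to 1; the slack leaves room
    for transported codes, whose edge vectors are one coordinate longer than the messages. *)
Lemma sup_rate_ge1 (R : realType) (P : nat -> nat -> Prop) :
  (forall K, exists k n, [/\ (K < k)%N, (0 < n)%N, (n <= k.+1)%N & P k n]) ->
  (1 <= sup_rate R P)%E.
Proof.
move=> ex; apply/lee_addgt0Pr => e e0.
(* [k > e^-1] gives [1 <= e * k.+1], as the case [n = k.+1] requires. *)
have [k [n [ltKk n0 le_nk Pkn]]] := ex (Num.bound e^-1).
apply: le_trans (_ : (k%:R / n%:R)%:E + e%:E <= _)%E; last first.
  rewrite leeD2r //; apply: ereal_sup_ubound; exists k, n; split=> //.
  exact: leq_ltn_trans ltKk.
have n_gt0 : 0 < n%:R :> R by rewrite ltr0n.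
rewrite -EFinD lee_fin -(ler_pM2r n_gt0) mul1r mulrDl divfK ?gt_eqF //.
have [le_nk'|lt_kn] := leqP n k.
  by rewrite ler_wpDr ?ler_nat // mulr_ge0 // ltW.
have -> : n = k.+1 by apply/eqP; rewrite eqn_leq le_nk.
rewrite -natr1 lerD2l mulrC -ler_pdivrMr // mul1r.
have /ltW/le_trans : e^-1 < (Num.bound e^-1)%:R.
  by apply: archi_boundP; rewrite invr_ge0 ltW.
by apply; rewrite natr1 ler_nat ltnW // ltnW.
Qed.

Lemma T8_capacity_over_ge1 (R : realType) (A : finType) :
  (1 < #|A|)%N -> (1 <= T8_capacity_over R A)%E.
Proof.
move=> A1; apply: sup_rate_ge1 => K.
(* This [m] forces [K < k], since [#|A| ^ K.+1 = m < 3 ^ m]. *)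
pose m := (#|A| ^ K.+1)%N; pose k := trunc_log #|A| (3 ^ m).
have /card_gt0P [a0 _] : (0 < #|A|)%N by exact: ltnW.
have cardF3 : #|'cV['F_3]_m| = (3 ^ m)%N by rewrite card_mx muln1 card_Fp.
have [|e [e' eK]] := @card_le_retract 'cV[A]_k 'cV['F_3]_m (const_mx a0).
  by rewrite cardF3 card_mx muln1 trunc_logP // expn_gt0.
have [|f [f' fK]] := @card_le_retract 'cV['F_3]_m 'cV[A]_k.+1 0.
  by rewrite cardF3 card_mx muln1 ltnW // trunc_log_ltn.
exists k, k.+1; split=> //.
  by rewrite /k trunc_log_max // ltnW // ltn_expl.
by apply: T8_transport eK fK (@T8_solution3 'F_3 m _); apply/val_inj.
Qed.

Lemma T8_capacity_over_le1 (R : realType) (A : finType) :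
  (1 < #|A|)%N -> (T8_capacity_over R A <= 1)%E.
Proof.
move=> A1; apply: sup_rate_le => k n _ [s sol].
by rewrite mul1r ler_nat (T8_solution_le A1 sol).
Qed.

Theorem corollary3p4 (R : realType) :
  (forall F : finFieldType, (3%N \notin [pchar F]) ->
     (T8_linear_capacity R F <= (48%:R / 49%:R : R)%:E)%E) /\
  (forall F : finFieldType, (3%N \in [pchar F]) ->
     T8_linear_capacity R F = 1%E) /\
  T8_capacity R = 1%E /\
  (forall A : finType, (1 < #|A|)%N -> T8_capacity_over R A = 1%E).
Proof.
have F1 (F : finFieldType) : (1 < #|F|)%N by exact: card_finNzRing_gt1.
split; last split; last split.
- move=> F; rewrite inE /= => F3; apply: sup_rate_le => k n _ [s [sol lin]].
  have le_kn := T8_solution_le (F1 F) sol.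
  have := T8_linear_bound F3 le_kn sol lin => le22.
  (* The bound amounts to [k / n <= 22 / 23], and 22/23 lies below 48/49. *)
  rewrite mulrAC ler_pdivlMr // -!natrM ler_nat; lia.
- move=> F; rewrite inE /= => /eqP F3.
  apply/eqP; rewrite eq_le; apply/andP; split.
    apply: sup_rate_le => k n _ [s [sol _]].
    by rewrite mul1r ler_nat (T8_solution_le (F1 F) sol).
  apply: sup_rate_ge1 => K; exists K.+1, K.+1; split=> //.
  exists (T8_code3 F K.+1); split; first exact: T8_solution3.
  exact: T8_linear3.
- apply/eqP; rewrite eq_le; apply/andP; split.
    apply: sup_rate_le => k n _ [A [A1 [s sol]]].
    by rewrite mul1r ler_nat (T8_solution_le A1 sol).
  apply: sup_rate_ge1 => K; exists K.+1, K.+1; split=> //.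
  exists 'F_3; split; first by rewrite card_Fp.
  by exists (T8_code3 'F_3 K.+1); apply: T8_solution3; apply/val_inj.
- move=> A A1; apply/eqP; rewrite eq_le.
  by rewrite T8_capacity_over_le1 ?T8_capacity_over_ge1.
Qed.
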